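(* Let $E$ be a Banach lattice. The following hold. (i) $\text{r-o-LW}(E)$ is a subalgebra of $\mathrm{L}_r(E)$. Moreover, $\text{r-o-LW}(E)=\mathrm{L}_r(E)$ if and only if the identity operator $I_E$ belongs to $\text{o-LW}(E)$. (ii) If $E$ is Dedekind complete, then $(\text{r-o-LW}(E),\|\cdot\|_{\text{r-o-LW}})$ is a closed Riesz subalgebra and an order ideal of $(\mathrm{L}_r(E),\|\cdot\|_r)$.
   Context: Vector spaces are real and operators are linear. A sequence $(x_n)$ in a Banach lattice is disjoint if $|x_n|\wedge|x_m|=0$ for $n\neq m$. For a subset $L$ of a Banach lattice, $\mathrm{sol}(L)$ is its solid hull. A bounded subset $L$ of a Banach lattice $F$ is an LW-set (LW-subset, also called L-weakly compact) if every disjoint sequence in $\mathrm{sol}(L)$ is norm null. A bounded operator $T:E\to F$ between Banach lattices is order LW (o-LW) if $T[0,x]$ is an LW-subset of $F$ for every $x\in E_+$. $\text{o-LW}(E)$ is the set of o-LW-operators $E\to E$. An operator $T:E\to E$ is a regularly o-LW-operator, $T\in\text{r-o-LW}(E)$, if $T=T_1-T_2$ with $T_1,T_2$ positive o-LW-operators. $\mathrm{L}_r(E)$ is the space of regular operators on $E$ (differences of two positive operators), with composition as multiplication, the order $S\le T$ iff $T-S$ is positive, and the regular norm $\|T\|_r=\inf\{\|S\|:\pm T\le S\}$ (equal to $\|\,|T|\,\|$ when $E$ is Dedekind complete). The norm on $\text{r-o-LW}(E)$ is $\|T\|_{\text{r-o-LW}}=\inf\{\|S\|:\pm T\le S\in\text{o-LW}(E)\}$.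 A Riesz subalgebra is a subalgebra that is also a vector sublattice. *)

(* Defs.v *)
From HB Require Import structures.
From mathcomp Require Import all_boot all_order all_algebra.
From mathcomp Require Import boolp classical_sets functions reals topology.
From mathcomp Require Import normedtype sequences.

Set Implicit Arguments.
Unset Strict Implicit.
Unset Printing Implicit Defensive.

Import Order.TTheory GRing.Theory Num.Theory.
Import numFieldNormedType.Exports.

Local Open Scope classical_set_scope.
Local Open Scope ring_scope.

(* The lattice order is a field of the structure and not inherited from
   [Order.Lattice]: Hierarchy Builder rejects a common substructure of
   [NormedModule] and of the ordered structures that [Num.NumDomain] and
   [Num.RealDomain] already join.  Two elements have [bjoin] and [bmeet] as
   supremum and infimum by [bleUx] and [blexI]. *)
HB.mixin Record NormedModule_isBanachLattice (R : realType)
    E of NormedModule R E := {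
  ble : rel E ;
  bjoin : E -> E -> E ;
  bmeet : E -> E -> E ;
  ble_refl : reflexive ble ;
  ble_anti : antisymmetric ble ;
  ble_trans : transitive ble ;
  bleUx : forall x y z : E, ble (bjoin x y) z = ble x z && ble y z ;
  blexI : forall x y z : E, ble z (bmeet x y) = ble z x && ble z y ;
  bleD2r : forall x y z : E, ble x y -> ble (x + z) (y + z) ;
  bleZ_ge0 : forall (a : R) (x : E), 0 <= a -> ble 0 x -> ble 0 (a *: x) ;
  ble_norm : forall x y : E,
    ble (bjoin x (- x)) (bjoin y (- y)) -> `|x| <= `|y|
}.

#[short(type="banachLatticeType")]
HB.structure Definition BanachLattice (R : realType) :=
  { E of CompleteNormedModule R E & NormedModule_isBanachLattice R E }.

Declare Scope blat_scope.
Delimit Scope blat_scope with BL.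
Notation "x <= y" := (ble x y) : blat_scope.
Notation "x <= y <= z" := (ble x y && ble y z) : blat_scope.

Section Lattice.
Context {R : realType} {E : banachLatticeType R}.

(* The modulus [|x|]; the notation [`|x|] is the norm. *)
Definition modulus (x : E) : E := bjoin x (- x).

Definition solid_hull (L : set E) : set E :=
  [set x | exists2 y, L y & (modulus x <= modulus y)%BL].

Definition disjoint_seq (u : nat -> E) : Prop :=
  forall n m, n != m -> bmeet (modulus (u n)) (modulus (u m)) = 0.

Definition LW_set (L : set E) : Prop :=
  bounded_set L /\
  forall u : nat -> E, (forall n, solid_hull L (u n)) -> disjoint_seq u ->
    u @ \oo --> (0 : E).

End Lattice.

Definition dedekind_complete {R : realType} (E : banachLatticeType R) : Prop :=
  forall A : set E, A !=set0 ->
    (exists u : E, forall x, A x -> (x <= u)%BL) ->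
    exists s : E, (forall x, A x -> (x <= s)%BL) /\
      forall u : E, (forall x, A x -> (x <= u)%BL) -> (s <= u)%BL.

(* Operators are functions satisfying the predicate [linear]; sums, scalar
   multiples and differences of operators are the pointwise ones of the
   function space [E -> F]. *)
Section Operators.
Context {R : realType}.
Context {E : banachLatticeType R} {F : banachLatticeType R}.
Implicit Types S T U : E -> F.

Definition bounded_operator T : Prop :=
  linear T /\ exists M : R, forall x, `|T x| <= M * `|x|.

Definition positive_operator T : Prop :=
  linear T /\ forall x : E, (0 <= x)%BL -> (0 <= T x)%BL.

Definition op_le S T : Prop := positive_operator (T - S).

Definition oLW : set (E -> F) :=
  [set T | bounded_operator T /\
     forall x : E, (0 <= x)%BL ->
       LW_set (T @` [set y : E | (0 <= y <= x)%BL])].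

(* Only meaningful for bounded operators. *)
Definition op_norm T : R := sup [set `|T x| | x in [set x : E | `|x| <= 1]].

End Operators.

Section OperatorAlgebra.
Context {R : realType} {E : banachLatticeType R}.
Implicit Types (A B : set (E -> E)) (S T U V : E -> E).

Definition regular : set (E -> E) :=
  [set T | exists T1 T2 : E -> E,
     [/\ positive_operator T1, positive_operator T2 & T = T1 - T2]].

Definition r_oLW : set (E -> E) :=
  [set T | exists T1 T2 : E -> E,
     [/\ positive_operator T1 /\ oLW T1, positive_operator T2 /\ oLW T2
       & T = T1 - T2]].

(* The set of majorants is nonempty when [T] is regular, and its members are
   positive operators, hence bounded. *)
Definition regular_norm T : R :=
  inf [set op_norm S | S in
    [set S | [/\ regular S, op_le T S & op_le (- T) S]]].

(* Idem when [T] is in [r_oLW]. *)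
Definition r_oLW_norm T : R :=
  inf [set op_norm S | S in
    [set S | [/\ oLW S, op_le T S & op_le (- T) S]]].

Definition op_subspace A : Prop :=
  A 0 /\ forall (a : R) S T, A S -> A T -> A (a *: S + T).

(* A subalgebra is not required to contain the identity operator. *)
Definition subalgebra_of B A : Prop :=
  [/\ A `<=` B, op_subspace A & forall S T, A S -> A T -> A (S \o T)].

(* Least upper and greatest lower bounds of two operators relative to the
   ordered space [B]. *)
Definition is_join_in B S T U : Prop :=
  [/\ B U, op_le S U, op_le T U &
     forall V, B V -> op_le S V -> op_le T V -> op_le U V].

Definition is_meet_in B S T U : Prop :=
  [/\ B U, op_le U S, op_le U T &
     forall V, B V -> op_le V S -> op_le V T -> op_le V U].

(* The lattice operations are those of the ambient space [B]. *)
Definition sublattice_of B A : Prop :=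
  A `<=` B /\ forall S T, A S -> A T ->
    (exists2 U, A U & is_join_in B S T U) /\
    (exists2 U, A U & is_meet_in B S T U).

Definition riesz_space B : Prop := op_subspace B /\ sublattice_of B B.

Definition riesz_subalgebra_of B A : Prop :=
  subalgebra_of B A /\ sublattice_of B A.

Definition is_modulus_in B T U : Prop := is_join_in B T (- T) U.

(* [riesz_space B] guarantees that the moduli in the last clause exist. *)
Definition order_ideal_of B A : Prop :=
  [/\ riesz_space B, A `<=` B, op_subspace A &
     forall S T absS absT, B S -> A T ->
       is_modulus_in B S absS -> is_modulus_in B T absT ->
       op_le absS absT -> A S].

Definition closed_in_norm B (N : (E -> E) -> R) A : Prop :=
  forall T, B T -> (forall e : R, 0 < e -> exists2 S, A S & N (T - S) < e) ->
    A T.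

End OperatorAlgebra.

Arguments oLW {R} E F.
Arguments regular {R} E.
Arguments r_oLW {R} E.

(* Main.v *)
Require Import Defs.
From HB Require Import structures.
From mathcomp Require Import all_boot all_order all_algebra.
From mathcomp Require Import boolp classical_sets functions reals topology.
From mathcomp Require Import normedtype sequences.
From mathcomp Require Import lra.

(** The key observation is that a positive operator [T] maps [[0, x]] into
    [[0, T x]] and reaches [T x], so the solid hull of [T [0, x]] is an order
    interval.  Hence [T] is o-LW exactly when every disjoint sequence below
    some [T x], [0 <= x], is norm null ([positive_oLWP]; boundedness is
    automatic by [positive_bounded]).  In other words, a positive o-LW operator
    is a positive operator with values in the order continuous part of [E].

    The positive elements of this part ([disjointly_null]) are closed under
    smaller elements, sums, positive multiples and norm limits, thanks to the
    Riesz decomposition of a disjoint sequence ([disjoint_seq_split],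
    [disjointly_null_approx]).  So the positive o-LW operators form a convex
    cone that is stable under composition and contains every positive operator
    below one of its members.  The claims on sums, products and the identity
    operator follow, and also [majorant_r_oLW]: an operator [T] such that [T]
    and [- T] have positive o-LW majorants is a difference of two of them.

    Let [E] be Dedekind complete.  By the Riesz-Kantorovich formula
    ([positive_part_exists]) a regular operator has a least positive majorant,
    its positive part, and with it come all joins and meets.  The positive part
    of an r-o-LW operator lies below an o-LW majorant and is therefore o-LW,
    which gives the sublattice property; the ideal property is a case of
    [majorant_r_oLW].  The modulus of an r-o-LW operator is o-LW and is the
    least majorant in either definition of the norm, so that the two norms
    agree.  Finally, if [T] is a limit of r-o-LW operators in the regular norm,
    the positive parts of [T] and [- T] lie, up to operators of small norm,
    below o-LW operators, and their values are disjointly null because the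
    order continuous part is norm closed ([approx_positive_part]). *)

Set Implicit Arguments.
Unset Strict Implicit.
Unset Printing Implicit Defensive.

Import Order.TTheory GRing.Theory Num.Theory.
Import numFieldNormedType.Exports.

Local Open Scope classical_set_scope.
Local Open Scope ring_scope.

(** * Order, modulus and norm *)

Section Order.
Context {R : realType} {E : banachLatticeType R}.
Implicit Types (x y z u v : E) (a : R).

Lemma bleT y x z : (x <= y)%BL -> (y <= z)%BL -> (x <= z)%BL.
Proof. exact: ble_trans. Qed.

Lemma bsubr_ge0 x y : (0 <= y - x)%BL = (x <= y)%BL.
Proof.
apply/idP/idP => h; first by have := bleD2r _ _ x h; rewrite add0r subrK.
by have := bleD2r _ _ (- x) h; rewrite subrr.
Qed.

Lemma bleD x y u v : (x <= y)%BL -> (u <= v)%BL -> (x + u <= y + v)%BL.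
Proof.
move=> xy uv; apply: (@bleT (y + u)); first exact: bleD2r.
by rewrite ![y + _]addrC; exact: bleD2r.
Qed.

Lemma baddr_ge0 x y : (0 <= x)%BL -> (0 <= y)%BL -> (0 <= x + y)%BL.
Proof. by move=> x0 y0; have := bleD x0 y0; rewrite addr0. Qed.

Lemma bleBlDr x y z : (x - y <= z)%BL = (x <= z + y)%BL.
Proof. by rewrite -bsubr_ge0 opprB addrA bsubr_ge0. Qed.

Lemma bleBrDr x y z : (x <= z - y)%BL = (x + y <= z)%BL.
Proof. by rewrite -bsubr_ge0 -addrA -opprD [y + x]addrC bsubr_ge0. Qed.

Lemma bleN2 x y : (- x <= - y)%BL = (y <= x)%BL.
Proof. by rewrite -bsubr_ge0 opprK addrC bsubr_ge0. Qed.

Lemma boppr_le0 x : (- x <= 0)%BL = (0 <= x)%BL.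
Proof. by rewrite -{1}oppr0 bleN2. Qed.

Lemma ble_addr x y : (0 <= y)%BL -> (x <= x + y)%BL.
Proof. by move=> y0; rewrite -bsubr_ge0 addrAC subrr add0r. Qed.

Lemma ble_addl x y : (0 <= y)%BL -> (x <= y + x)%BL.
Proof. by rewrite addrC; exact: ble_addr. Qed.

Lemma bleZ a x y : 0 <= a -> (x <= y)%BL -> (a *: x <= a *: y)%BL.
Proof.
move=> a0; rewrite -bsubr_ge0 => /(bleZ_ge0 _ _ a0).
by rewrite scalerBr bsubr_ge0.
Qed.

Lemma ble_joinl x y : (x <= bjoin x y)%BL.
Proof. by have := ble_refl (bjoin x y); rewrite bleUx => /andP[]. Qed.

Lemma ble_joinr x y : (y <= bjoin x y)%BL.
Proof. by have := ble_refl (bjoin x y); rewrite bleUx => /andP[]. Qed.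

Lemma ble_meetl x y : (bmeet x y <= x)%BL.
Proof. by have := ble_refl (bmeet x y); rewrite blexI => /andP[]. Qed.

Lemma ble_meetr x y : (bmeet x y <= y)%BL.
Proof. by have := ble_refl (bmeet x y); rewrite blexI => /andP[]. Qed.

Lemma beq x y : (x <= y)%BL -> (y <= x)%BL -> x = y.
Proof. by move=> xy yx; apply: ble_anti; rewrite xy. Qed.

Lemma ble_modulus x : (x <= modulus x)%BL.
Proof. exact: ble_joinl. Qed.

Lemma modulus_le x y : (modulus x <= y)%BL = (x <= y)%BL && (- x <= y)%BL.
Proof. exact: bleUx. Qed.

Lemma modulusN x : modulus (- x) = modulus x.
Proof.
have le y : (modulus (- y) <= modulus y)%BL.
  by rewrite modulus_le opprK /modulus ble_joinl ble_joinr.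
by apply: beq => //; rewrite -{1}[x]opprK.
Qed.

Lemma bge0_double x : (0 <= x + x)%BL -> (0 <= x)%BL.
Proof.
move=> h; have <- : 2^-1 *: (x + x) = x.
  by rewrite scalerDr -scalerDl (_ : 2^-1 + 2^-1 = 1 :> R) ?scale1r//; lra.
by apply: bleZ_ge0 => //; rewrite invr_ge0.
Qed.

Lemma modulus_ge0 x : (0 <= modulus x)%BL.
Proof.
apply: bge0_double; rewrite -(subrr x); apply: bleD; first exact: ble_modulus.
exact: ble_joinr.
Qed.

Lemma modulus_id x : (0 <= x)%BL -> modulus x = x.
Proof.
move=> x0; apply: beq; last exact: ble_modulus.
by rewrite modulus_le ble_refl (bleT _ x0)// boppr_le0.
Qed.

Lemma ler_norm_modulus x y : (modulus x <= modulus y)%BL -> `|x| <= `|y|.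
Proof. exact: ble_norm. Qed.

Lemma norm_modulus x : `|modulus x| = `|x|.
Proof.
have e := modulus_id (modulus_ge0 x).
by apply/eqP; rewrite eq_le !ler_norm_modulus// e ble_refl.
Qed.

Lemma ler_norm_ble x y : (0 <= x)%BL -> (x <= y)%BL -> `|x| <= `|y|.
Proof.
move=> x0 xy; apply: ler_norm_modulus; rewrite modulus_id //.
by rewrite modulus_id// (bleT x0).
Qed.

(** The infimum with [x] takes the largest part of [z] that fits under [x];
    what is left over automatically fits under [y]. *)
Lemma riesz_decomposition z x y :
  (0 <= x)%BL -> (0 <= y)%BL -> (0 <= z)%BL -> (z <= x + y)%BL ->
  exists v w, [/\ z = v + w, (0 <= v <= x)%BL & (0 <= w <= y)%BL].
Proof.
move=> x0 y0 z0 zxy; exists (bmeet z x), (z - bmeet z x); split.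
- by rewrite addrC subrK.
- by rewrite blexI z0 x0 ble_meetr.
- rewrite bsubr_ge0 ble_meetl bleBlDr addrC -bleBlDr blexI.
  by rewrite !bleBlDr zxy ble_addr.
Qed.

(** Negative parts are 1-Lipschitz: [bjoin (- l) 0 <= modulus (l - u n)] as
    soon as [u n] is positive, so the negative part of a limit vanishes. *)
Lemma cvg_bge0 (u : nat -> E) l :
  u @ \oo --> l -> (\forall n \near \oo, (0 <= u n)%BL) -> (0 <= l)%BL.
Proof.
move=> ul u0; suff /normr0_eq0 l0 : `|bjoin (- l) 0| = 0.
  by rewrite -boppr_le0 -l0 ble_joinl.
apply/eqP; rewrite eq_le normr_ge0 andbT; apply/ler_addgt0Pl => e e0.
have [N _ NP] := filterI u0 (cvgr_dist_lt u l ul e e0).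
have [/= un0 /ltW lun] := NP N (leqnn N).
rewrite addr0 (le_trans _ lun)// -norm_modulus -[leRHS]norm_modulus.
have j0 : (0 <= bjoin (- l) 0)%BL by exact: ble_joinr.
rewrite (modulus_id j0); apply: ler_norm_ble => //.
rewrite bleUx modulus_ge0 andbT -modulusN (bleT _ (ble_modulus _))//.
by rewrite opprB ble_addl.
Qed.

End Order.

(** * Positive operators *)

Section PositiveOperators.
Context {R : realType} {E : banachLatticeType R}.
Implicit Types (S T U V : E -> E) (x y z : E) (a : R).

Section LinearFunction.
Variables (T : E -> E) (linT : linear T).

Lemma lin0 : T 0 = 0.
Proof. by have /= := zmod_morphism_linear linT 0 0; rewrite !subrr. Qed.

Lemma linB x y : T (x - y) = T x - T y.
Proof. exact: (zmod_morphism_linear linT). Qed.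

Lemma linN x : T (- x) = - T x.
Proof. by rewrite -sub0r linB lin0 sub0r. Qed.

Lemma linD x y : T (x + y) = T x + T y.
Proof. by rewrite -{1}[y]opprK linB linN opprK. Qed.

Lemma linZ a x : T (a *: x) = a *: T x.
Proof. exact: (scalable_linear linT). Qed.

End LinearFunction.

Lemma lin_comb a S T : linear S -> linear T -> linear (a *: S + T).
Proof.
move=> linS linT b x y; rewrite !fctE linS linT !scalerDr !scalerA.
by rewrite [a * b]mulrC addrACA.
Qed.

Lemma lin_add S T : linear S -> linear T -> linear (S + T).
Proof. by move=> linS linT; rewrite -[S]scale1r; exact: lin_comb. Qed.

Lemma lin_sub S T : linear S -> linear T -> linear (S - T).
Proof. by move=> linS linT; rewrite addrC -scaleN1r; exact: lin_comb. Qed.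

Lemma positive_comb a S T : 0 <= a ->
  positive_operator S -> positive_operator T -> positive_operator (a *: S + T).
Proof.
move=> a0 [linS S0] [linT T0]; split=> [|x x0]; first exact: lin_comb.
by rewrite !fctE; apply: baddr_ge0; [apply: bleZ_ge0|]; auto.
Qed.

Lemma positiveD S T :
  positive_operator S -> positive_operator T -> positive_operator (S + T).
Proof. by rewrite -{2}[S]scale1r; exact: positive_comb. Qed.

Lemma positive0 : positive_operator (0 : E -> E).
Proof.
split=> [a x y|x _]; first by rewrite [RHS]addr0 [RHS]scaler0.
exact: ble_refl.
Qed.

Lemma positive_comp S T :
  positive_operator S -> positive_operator T -> positive_operator (S \o T).
Proof.
move=> [linS S0] [linT T0]; split=> [a x y|x x0] /=; first by rewrite linT linS.
by apply/S0/T0.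
Qed.

Lemma positive_homo T x y :
  positive_operator T -> (x <= y)%BL -> (T x <= T y)%BL.
Proof.
by move=> [linT T0]; rewrite -bsubr_ge0 => /T0; rewrite linB// bsubr_ge0.
Qed.

Lemma positive_modulus T x :
  positive_operator T -> (modulus (T x) <= T (modulus x))%BL.
Proof.
move=> T0; rewrite modulus_le -(linN T0.1) !(positive_homo T0) ?ble_modulus//.
by rewrite -modulusN ble_modulus.
Qed.

Lemma op_leP S T x : op_le S T -> (0 <= x)%BL -> (S x <= T x)%BL.
Proof. by move=> [_ h] /h; rewrite bsubr_ge0. Qed.

Lemma op_le_intro S T : linear S -> linear T ->
  (forall x, (0 <= x)%BL -> (S x <= T x)%BL) -> op_le S T.
Proof.
move=> linS linT h; split; first exact: lin_sub.
by move=> x /h; rewrite bsubr_ge0.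
Qed.

Lemma op_le_trans S T U : op_le S T -> op_le T U -> op_le S U.
Proof.
by move=> ST TU; rewrite /op_le -(subrK T U) -addrA; exact: positiveD.
Qed.

Lemma op_leD S T U V : op_le S T -> op_le U V -> op_le (S + U) (T + V).
Proof. by move=> ST UV; rewrite /op_le opprD addrACA; exact: positiveD. Qed.

(** Automatic continuity; it makes the boundedness clause of [oLW] free for
    positive operators.  If it failed, there would be
    [y n >= 0] of norm [2^-n] with [n < `|T (y n)|]; their sum [l] exists by
    completeness and dominates every [y n], so that the norm of [T l] exceeds
    every [n]. *)
Lemma positive_bounded T : positive_operator T -> bounded_operator T.
Proof.
move=> T0; split; first exact: T0.1.
apply: contrapT => /forallNP unb.
have [y yP] : {y : nat -> E & forall n,
    [/\ (0 <= y n)%BL, `|y n| <= 2^-1 ^+ n & n%:R < `|T (y n)|]}.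
  suff h n : exists y : E, [/\ (0 <= y)%BL, `|y| <= 2^-1 ^+ n & n%:R < `|T y|].
    by have [y yP] := choice h; exists y.
  (* The factor [2 ^+ n] leaves a bound of [n] after normalizing [x] to have
     norm [2^-n]. *)
  have /existsNP[x /negP] := unb (n%:R * 2 ^+ n); rewrite -ltNge => Tx.
  have x0 : 0 < `|x|.
    rewrite normr_gt0; apply: contraTneq Tx => ->.
    by rewrite (lin0 T0.1) normr0 mulr0 ltxx.
  have p0 : 0 < 2 ^+ n :> R by rewrite exprn_gt0.
  pose c := (2 ^+ n * `|x|)^-1.
  have c0 : 0 < c by rewrite invr_gt0 mulr_gt0.
  exists (c *: modulus x); split.
  - by rewrite bleZ_ge0 ?ltW// modulus_ge0.
  - rewrite normrZ norm_modulus gtr0_norm// /c invfM mulfVK ?gt_eqF//.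
    by rewrite exprVn.
  - rewrite (linZ T0.1) normrZ gtr0_norm//.
    have : `|T x| <= `|T (modulus x)|.
      rewrite -norm_modulus ler_norm_ble ?modulus_ge0//.
      exact: positive_modulus.
    rewrite -(ler_pM2l c0); apply: lt_le_trans.
    by rewrite mulrC ltr_pdivlMr ?mulr_gt0// mulrA.
have cvy : cvgn (series y).
  apply/normed_cvg.
  apply/(@series_le_cvg _ _ (geometric 1 2^-1)) => [n|n|n|].
  - exact: normr_ge0.
  - by rewrite /= mul1r exprn_ge0// invr_ge0.
  - by rewrite /= mul1r; have [] := yP n.
  - by apply: is_cvg_geometric_series; rewrite ger0_norm; lra.
set l := limn (series y).
have yl n : (y n <= l)%BL.
  (* [l - y n] is the limit of [series y N - y n], which is positive once
     [N > n]; then the closedness of the cone applies. *)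
  rewrite -bsubr_ge0.
  have sum0 N : (0 <= series y N)%BL.
    elim: N => [|N IH]; first by rewrite /series /= big_geq// ble_refl.
    by rewrite seriesSr baddr_ge0//; have [] := yP N.
  have : series y N - y n @[N --> \oo] --> l - y n.
    by apply: cvgB => //; exact: cvg_cst.
  move=> /cvg_bge0; apply; exists n.+1 => // N /=.
  elim: N => // N IH; rewrite ltnS leq_eqVlt => /orP[/eqP <-|/IH nN].
    by rewrite seriesSr addrK sum0.
  by rewrite seriesSr addrAC baddr_ge0//; have [] := yP N.
have := archi_boundP (normr_ge0 (T l)); set m := Num.Def.archi_bound _ => lm.
have [ym0 _ mT] := yP m.
have : `|T (y m)| <= `|T l|.
  by rewrite ler_norm_ble ?(positive_homo T0)//; exact: T0.2.
by rewrite leNgt (lt_trans lm mT).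
Qed.

Lemma has_ubound_op_norm T : bounded_operator T ->
  has_ubound [set `|T x| | x in [set x : E | `|x| <= 1]].
Proof.
move=> [_ [M bM]]; exists `|M| => _ [y /= y1 <-]; apply: le_trans (bM y) _.
rewrite (le_trans (ler_wpM2r _ (ler_norm M)))//.
by rewrite -[leRHS]mulr1 ler_wpM2l.
Qed.

Lemma op_norm_ge0 T : bounded_operator T -> 0 <= op_norm T.
Proof.
move=> bT; apply: le_trans (normr_ge0 (T 0)) _; apply: ub_le_sup.
  exact: has_ubound_op_norm.
by exists 0; rewrite //= normr0.
Qed.

Lemma ler_op_norm T x : bounded_operator T -> `|T x| <= op_norm T * `|x|.
Proof.
move=> bT; have linT := bT.1; have [->|x0] := eqVneq x 0.
  by rewrite (lin0 linT) !normr0 mulr0.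
have nx : 0 < `|x| by rewrite normr_gt0.
rewrite -ler_pdivrMr//; apply: ub_le_sup; first exact: has_ubound_op_norm.
exists (`|x|^-1 *: x) => /=.
  by rewrite normrZ normfV normr_id mulVf ?gt_eqF.
by rewrite (linZ linT) normrZ normfV normr_id mulrC.
Qed.

(** A vector and its modulus have the same norm, so it suffices to compare
    [S] and [T] on the positive cone. *)
Lemma op_norm_homo S T :
  positive_operator S -> op_le S T -> op_norm S <= op_norm T.
Proof.
move=> S0 ST; have T0 : positive_operator T.
  by rewrite -(subrK S T); exact: positiveD.
apply: ge_sup; first by exists `|S 0|; exists 0; rewrite //= normr0.
move=> _ [x /= x1 <-].
have h : `|S x| <= `|T (modulus x)|.
  rewrite -norm_modulus ler_norm_ble ?modulus_ge0//.
  apply: (bleT (positive_modulus _ S0)).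
  exact: (op_leP ST (modulus_ge0 x)).
apply: (le_trans h); apply: ub_le_sup.
  exact/has_ubound_op_norm/positive_bounded.
by exists (modulus x) => //=; rewrite norm_modulus.
Qed.

End PositiveOperators.

(** * Disjointly null elements *)

Section DisjointlyNull.
Context {R : realType} {E : banachLatticeType R}.
Implicit Types (u v s : nat -> E) (x z w r : E) (a e : R).

(** For [0 <= z], this says that the order interval [[-z, z]] is an LW-set;
    such [z] are the positive elements of the order continuous part of [E]. *)
Definition disjointly_null z : Prop :=
  forall u, (forall n, (modulus (u n) <= z)%BL) -> disjoint_seq u ->
    u @ \oo --> (0 : E).

Lemma disjoint_seq_le u v : (forall n, (modulus (v n) <= modulus (u n))%BL) ->
  disjoint_seq u -> disjoint_seq v.
Proof.
move=> vu du n m nm; apply: beq; last by rewrite blexI !modulus_ge0.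
by rewrite -(du n m nm) blexI (bleT (ble_meetl _ _))// (bleT (ble_meetr _ _)).
Qed.

Lemma disjointly_null_le z w :
  (z <= w)%BL -> disjointly_null w -> disjointly_null z.
Proof. by move=> zw nw u uz; apply: nw => n; exact: bleT zw. Qed.

Lemma disjointly_null0 : disjointly_null 0.
Proof.
move=> u u0 _; have -> : u = fun=> 0; last exact: cvg_cst.
apply/funext => n; have m0 := beq (u0 n) (modulus_ge0 (u n)).
by apply/eqP; rewrite -normr_eq0 -norm_modulus m0 normr0.
Qed.

(** Riesz decomposition of each [modulus (u n)] produces dominated, hence again
    disjoint, sequences. *)
Lemma disjoint_seq_split u w r : (0 <= w)%BL -> (0 <= r)%BL ->
  disjoint_seq u -> (forall n, (modulus (u n) <= w + r)%BL) ->
  exists v s, [/\ disjoint_seq v, disjoint_seq s,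
    forall n, modulus (u n) = v n + s n,
    forall n, (0 <= v n <= w)%BL & forall n, (0 <= s n <= r)%BL].
Proof.
move=> w0 r0 du uwr.
have h n : exists p : E * E, [/\ modulus (u n) = p.1 + p.2,
    (0 <= p.1 <= w)%BL & (0 <= p.2 <= r)%BL].
  have [v [s [? ? ?]]] := riesz_decomposition w0 r0 (modulus_ge0 (u n)) (uwr n).
  by exists (v, s).
have [p pP] := choice h.
exists (fun n => (p n).1), (fun n => (p n).2); split.
- apply: disjoint_seq_le du => n; have [-> /andP[v0 _] /andP[s0 _]] := pP n.
  by rewrite modulus_id// ble_addr.
- apply: disjoint_seq_le du => n; have [-> /andP[v0 _] /andP[s0 _]] := pP n.
  by rewrite modulus_id// ble_addl.
- by move=> n; have [] := pP n.
- by move=> n; have [] := pP n.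
- by move=> n; have [] := pP n.
Qed.

(** The order continuous part is norm closed: up to a summand of norm less than
    [e], a disjoint sequence below [z] lives below some [w] of that part. *)
Lemma disjointly_null_approx z :
  (forall e, 0 < e -> exists w r, [/\ (0 <= w)%BL, (0 <= r)%BL,
     disjointly_null w, `|r| < e & (z <= w + r)%BL]) ->
  disjointly_null z.
Proof.
move=> hz u uz du; apply/cvgr0Pnorm_lt => e e0.
have e2 : 0 < e / 2 by rewrite divr_gt0.
have [w [r [w0 r0 nw re zwr]]] := hz _ e2.
have [|v [s [dv ds us vw sr]]] := disjoint_seq_split w0 r0 du.
  by move=> n; exact: bleT zwr.
have v_cvg0 : v @ \oo --> (0 : E).
  by apply: nw dv => n; have /andP[v0 ?] := vw n; rewrite modulus_id.
apply: filterS (proj1 (cvgr0Pnorm_lt v) v_cvg0 _ e2) => n vn.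
rewrite -norm_modulus us [e]splitr.
apply: le_lt_trans (ler_normD _ _) _; apply: ltrD => //.
by apply: le_lt_trans re; have /andP[? ?] := sr n; exact: ler_norm_ble.
Qed.

Lemma disjointly_nullD w r : (0 <= w)%BL -> (0 <= r)%BL ->
  disjointly_null w -> disjointly_null r -> disjointly_null (w + r).
Proof.
move=> w0 r0 nw nr u uwr du.
have [v [s [dv ds us vw sr]]] := disjoint_seq_split w0 r0 du uwr.
have : v n + s n @[n --> \oo] --> (0 + 0 : E).
  apply: cvgD.
    by apply: nw dv => n; have /andP[? ?] := vw n; rewrite modulus_id.
  by apply: nr ds => n; have /andP[? ?] := sr n; rewrite modulus_id.
rewrite addr0 => /cvgr0Pnorm_lt h; apply/cvgr0Pnorm_lt => e /h vs_e.
by apply: filterS vs_e => n; rewrite -us norm_modulus.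
Qed.

(** Reduces to sums: [a *: z <= z *+ n] for a natural number [n >= a]. *)
Lemma disjointly_nullZ a z : 0 <= a -> (0 <= z)%BL ->
  disjointly_null z -> disjointly_null (a *: z).
Proof.
move=> a0 z0 nz; apply: (@disjointly_null_le _ (z *+ Num.bound a)).
  rewrite -scaler_nat -bsubr_ge0 -scalerBl; apply: bleZ_ge0 => //.
  by rewrite subr_ge0 ltW// archi_boundP.
have h n : (0 <= z *+ n)%BL /\ disjointly_null (z *+ n).
  elim: n => [|n [n0 nn]].
    by split; [exact: ble_refl|exact: disjointly_null0].
  rewrite mulrS.
  by split; [exact: (baddr_ge0 z0 n0)|exact: (disjointly_nullD z0 n0 nz nn)].
by have [] := h (Num.bound a).
Qed.

End DisjointlyNull.

(** * Positive order LW operators *)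

Section PositiveOLW.
Context {R : realType} {E : banachLatticeType R}.
Implicit Types (S T U V A B : E -> E) (x y z : E) (a e : R).

(** The solid hull of [T [0, x]] is the order interval [[- T x, T x]], because
    [T x] is the largest element of [T [0, x]]. *)
Lemma positive_oLWP T : positive_operator T ->
  oLW E E T <-> forall x, (0 <= x)%BL -> disjointly_null (T x).
Proof.
move=> T0; split=> [[_ LW] x x0 u uTx|nT].
  apply: (LW x x0).2 => n; exists (T x).
    by exists x; rewrite //= x0 ble_refl.
  by rewrite (modulus_id (T0.2 _ x0)).
split; first exact: positive_bounded.
move=> x x0; split.
  exists `|T x|; split; first exact: num_real.
  move=> M TM _ [y /= /andP[y0 yx] <-]; apply: le_trans (ltW TM).
  by apply: ler_norm_ble; [exact: T0.2|exact: positive_homo].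
move=> u uh du; apply: (nT x x0 u _ du) => n.
have [_ [y /= /andP[y0 yx] <-] uTy] := uh n; apply: bleT uTy _.
by rewrite modulus_id; [exact: positive_homo|exact: T0.2].
Qed.

Definition positive_oLW : set (E -> E) :=
  [set T | positive_operator T /\ oLW E E T].

Lemma positive_oLW_null T x :
  positive_oLW T -> (0 <= x)%BL -> disjointly_null (T x).
Proof. by move=> [T0 /(positive_oLWP T0)]; exact. Qed.

Lemma positive_oLW_intro T : positive_operator T ->
  (forall x, (0 <= x)%BL -> disjointly_null (T x)) -> positive_oLW T.
Proof. by move=> T0 nT; split=> //; exact/positive_oLWP. Qed.

Lemma positive_oLW0 : positive_oLW 0.
Proof.
apply: positive_oLW_intro => [|x _]; first exact: positive0.
exact: disjointly_null0.
Qed.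

Lemma positive_oLW_comb a S T : 0 <= a ->
  positive_oLW S -> positive_oLW T -> positive_oLW (a *: S + T).
Proof.
move=> a0 oS oT; have [S0 T0] := (oS.1, oT.1).
apply: positive_oLW_intro => [|x x0]; first exact: positive_comb.
have [Sx Tx] := (S0.2 x x0, T0.2 x x0).
apply: disjointly_nullD => //; first exact: bleZ_ge0.
  by apply: disjointly_nullZ => //; exact: positive_oLW_null.
exact: positive_oLW_null.
Qed.

Lemma positive_oLWD S T :
  positive_oLW S -> positive_oLW T -> positive_oLW (S + T).
Proof. by rewrite -{2}[S]scale1r; exact: positive_oLW_comb. Qed.

Lemma positive_oLW_comp S T :
  positive_oLW S -> positive_oLW T -> positive_oLW (S \o T).
Proof.
move=> oS oT; apply: positive_oLW_intro => [|x x0].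
  by apply: positive_comp; [exact: oS.1|exact: oT.1].
exact: (positive_oLW_null oS (oT.1.2 x x0)).
Qed.

Lemma positive_oLW_le S T :
  positive_operator S -> op_le S T -> positive_oLW T -> positive_oLW S.
Proof.
move=> S0 ST oT; apply: positive_oLW_intro => // x x0.
by apply: disjointly_null_le (op_leP ST x0) _; exact: positive_oLW_null.
Qed.

(** Both [regular] and [r_oLW] are convertible to sets of this form, for the
    convex cones of positive and of positive o-LW operators. *)
Definition differences (C : set (E -> E)) : set (E -> E) :=
  [set T | exists T1 T2 : E -> E, [/\ C T1, C T2 & T = T1 - T2]].

Lemma differences_subspace (C : set (E -> E)) : C 0 ->
  (forall a S T, 0 <= a -> C S -> C T -> C (a *: S + T)) ->
  op_subspace (differences C).
Proof.
move=> C0 CD; split; first by exists 0, 0; rewrite subr0.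
move=> a _ _ [S1 [S2 [cS1 cS2 ->]]] [T1 [T2 [cT1 cT2 ->]]].
have [a0|a0] := leP 0 a.
  exists (a *: S1 + T1), (a *: S2 + T2); split; rewrite ?scalerBr; auto.
  by rewrite opprD addrACA.
have Na0 : 0 <= - a by rewrite oppr_ge0 ltW.
exists (- a *: S2 + T1), (- a *: S1 + T2); split; auto.
by rewrite opprD addrACA !scaleNr opprK scalerBr [a *: S1 - _]addrC.
Qed.

Lemma regular_subspace : op_subspace (regular E).
Proof.
by apply: differences_subspace; [exact: positive0|exact: positive_comb].
Qed.

Lemma r_oLW_subspace : op_subspace (r_oLW E).
Proof.
by apply: differences_subspace; [exact: positive_oLW0|exact: positive_oLW_comb].
Qed.

Lemma r_oLW_regular : r_oLW E `<=` regular E.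
Proof. by move=> T [T1 [T2 [[? _] [? _] ->]]]; exists T1, T2. Qed.

Lemma positive_regular T : positive_operator T -> regular E T.
Proof.
by move=> T0; exists T, 0; split; rewrite ?subr0//; exact: positive0.
Qed.

Lemma positive_oLW_r_oLW T : positive_oLW T -> r_oLW E T.
Proof.
by move=> oT; exists T, 0; split; rewrite ?subr0//; exact: positive_oLW0.
Qed.

Lemma regular_linear T : regular E T -> linear T.
Proof. by move=> [T1 [T2 [[? _] [? _] ->]]]; exact: lin_sub. Qed.

Lemma op_le_addl S T : positive_operator S -> op_le T (T + S).
Proof. by rewrite /op_le addrAC subrr add0r. Qed.

Lemma op_le_subl S T : positive_operator S -> op_le (T - S) T.
Proof. by rewrite /op_le opprB addrC subrK. Qed.

Lemma op_le_sub_add A B : positive_operator A -> positive_operator B ->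
  op_le (A - B) (A + B).
Proof.
by move=> A0 B0; apply: op_le_trans (op_le_subl _ B0) _; exact: op_le_addl.
Qed.

Lemma r_oLW_majorant T : r_oLW E T ->
  exists A, [/\ positive_oLW A, op_le T A & op_le (- T) A].
Proof.
move=> [A [B [oA oB ->]]]; exists (A + B); split; first exact: positive_oLWD.
  exact: op_le_sub_add oA.1 oB.1.
by rewrite opprB [A + B]addrC; exact: op_le_sub_add oB.1 oA.1.
Qed.

(** Write [T = A - (A - T)] and note [0 <= A - T <= A + B]. *)
Lemma majorant_r_oLW T A B : positive_oLW A -> positive_oLW B ->
  op_le T A -> op_le (- T) B -> r_oLW E T.
Proof.
move=> oA oB TA TB; exists A, (A - T); split=> //; last first.
  by rewrite opprB addrC subrK.
apply: (positive_oLW_le (T := A + B)) => //; last exact: positive_oLWD.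
rewrite /op_le opprB addrC addrA subrK addrC.
by move: TB; rewrite /op_le opprK.
Qed.

Lemma r_oLW_comp S T : r_oLW E S -> r_oLW E T -> r_oLW E (S \o T).
Proof.
move=> [S1 [S2 [oS1 oS2 ->]]] [T1 [T2 [oT1 oT2 ->]]].
exists ((S1 \o T1) + (S2 \o T2)), ((S1 \o T2) + (S2 \o T1)).
split.
- exact: positive_oLWD (positive_oLW_comp oS1 oT1) (positive_oLW_comp oS2 oT2).
- exact: positive_oLWD (positive_oLW_comp oS1 oT2) (positive_oLW_comp oS2 oT1).
apply/funext => x /=; rewrite !fctE /= (linB oS1.1.1) (linB oS2.1.1).
by rewrite opprB opprD addrACA.
Qed.

End PositiveOLW.

(** * The Riesz-Kantorovich positive part *)

Section PositivePart.
Context {R : realType} {E : banachLatticeType R}.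
Implicit Types (S T U V A B P : E -> E) (x y z p q : E) (a e : R).

(** Extend by [p - q |-> f p - f q]; additivity makes this independent of the
    chosen decomposition. *)
Lemma positive_extension (f : E -> E) :
  (forall x y, (0 <= x)%BL -> (0 <= y)%BL -> f (x + y) = f x + f y) ->
  (forall a x, 0 <= a -> (0 <= x)%BL -> f (a *: x) = a *: f x) ->
  (forall x, (0 <= x)%BL -> (0 <= f x)%BL) ->
  exists P, positive_operator P /\ forall x, (0 <= x)%BL -> P x = f x.
Proof.
move=> fD fZ f0.
have f00 : f 0 = 0 by rewrite -[X in f X](scale0r 0) fZ ?scale0r ?ble_refl.
pose pos x := bjoin x 0; pose neg x := pos x - x.
have pos0 x : (0 <= pos x)%BL by exact: ble_joinr.
have neg0 x : (0 <= neg x)%BL by rewrite bsubr_ge0 ble_joinl.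
have posneg x : x = pos x - neg x by rewrite /neg opprB addrC subrK.
pose P x := f (pos x) - f (neg x).
have PB p q : (0 <= p)%BL -> (0 <= q)%BL -> P (p - q) = f p - f q.
  move=> p0 q0; apply/eqP.
  rewrite /P subr_eq addrAC eq_sym subr_eq -!fD//; apply/eqP; congr f.
  by rewrite /neg opprB addrC -addrA subrK.
have Pf x : (0 <= x)%BL -> P x = f x.
  by move=> x0; rewrite -[x in LHS]subr0 PB ?ble_refl// f00 subr0.
exists P; split=> //; split; last by move=> x x0; rewrite Pf//; exact: f0.
clearbody neg pos.
move=> a x y; rewrite {1}(posneg x) {1}(posneg y) scalerBr.
have [a0|/ltW a0] := leP 0 a.
  rewrite addrACA -opprD PB ?baddr_ge0 ?bleZ_ge0//.
  by rewrite !fD ?bleZ_ge0// !fZ// opprD addrACA -scalerBr.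
have Na0 : 0 <= - a by rewrite oppr_ge0.
rewrite -scaleNr -[a *: pos x]opprK -scaleNr [- _ + _]addrC addrACA -opprD.
rewrite PB ?baddr_ge0 ?bleZ_ge0// !fD ?bleZ_ge0// !fZ// opprD addrACA.
by rewrite !scaleNr opprK [- _ + _]addrC -scalerBr.
Qed.

Definition is_positive_part T P : Prop :=
  [/\ positive_operator P, op_le T P &
      forall V, positive_operator V -> op_le T V -> op_le P V].

(** The positive part is [x |-> sup {T y : 0 <= y <= x}] on the positive cone;
    Riesz decomposition makes it additive. *)
Lemma positive_part_exists T A : dedekind_complete E -> linear T ->
  positive_operator A -> op_le T A -> exists P, is_positive_part T P.
Proof.
move=> dcE linT A0 TA.
pose img x := [set T y | y in [set y | (0 <= y <= x)%BL]].
have /choice[f fP] x : exists s, (0 <= x)%BL ->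
    (forall y, (0 <= y)%BL -> (y <= x)%BL -> (T y <= s)%BL) /\
    (forall u, (forall y, (0 <= y)%BL -> (y <= x)%BL -> (T y <= u)%BL) ->
       (s <= u)%BL).
  have [x0|/negP nx0] := boolP (0 <= x)%BL; last by exists 0.
  have [||s [sub slub]] := dcE (img x).
  - by exists (T 0), 0; rewrite //= ble_refl.
  - exists (A x) => _ [y /= /andP[y0 yx] <-].
    exact: bleT (op_leP TA y0) (positive_homo A0 yx).
  exists s => _; split=> [y y0 yx|u hu].
    by apply: sub; exists y; rewrite //= y0.
  by apply: slub => _ [y /= /andP[y0 yx] <-]; exact: hu.
have ub x y : (0 <= y)%BL -> (y <= x)%BL -> (T y <= f x)%BL.
  by move=> y0 yx; exact: (fP x (bleT y0 yx)).1.
have lub x u : (0 <= x)%BL ->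
    (forall y, (0 <= y)%BL -> (y <= x)%BL -> (T y <= u)%BL) -> (f x <= u)%BL.
  by move=> x0; exact: (fP x x0).2.
(* [y = 0] is admissible in the supremum. *)
have f0 x : (0 <= x)%BL -> (0 <= f x)%BL.
  by move=> x0; rewrite -(lin0 linT) ub ?ble_refl.
(* The reverse inequality, for [a != 0], is this one with [a^-1] and [a *: x]
   in the place of [a] and [x]. *)
have fZ_le a x : 0 <= a -> (0 <= x)%BL -> (f (a *: x) <= a *: f x)%BL.
  move=> a0 x0; apply/lub; first exact: bleZ_ge0.
  move=> y y0; have [-> yx|an0] := eqVneq a 0.
    move: yx; rewrite !scale0r => yx.
    by rewrite (beq yx y0) (lin0 linT) ble_refl.
  move=> yx; rewrite -(scalerKV an0 y) (linZ linT); apply: bleZ => //.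
  have ia0 : 0 <= a^-1 by rewrite invr_ge0.
  apply/ub; first exact: bleZ_ge0.
  by rewrite -[x](scalerK an0); exact: bleZ.
have [x y x0 y0|a x a0 x0||P [P0 Pf]] := @positive_extension f.
- apply: beq.
    apply/lub => [|z z0 zxy]; first exact: baddr_ge0.
    have [v [w [-> /andP[v0 vx] /andP[w0 wy]]]] :=
      riesz_decomposition x0 y0 z0 zxy.
    by rewrite (linD linT); apply: bleD; exact: ub.
  rewrite -bleBrDr; apply/lub => // v v0 vx.
  rewrite bleBrDr addrC -bleBrDr; apply/lub => // w w0 wy.
  rewrite bleBrDr -(linD linT); apply/ub; first exact: baddr_ge0.
  by rewrite addrC; exact: bleD.
- apply: beq; first exact: fZ_le.
  have [->|an0] := eqVneq a 0; first by rewrite !scale0r f0// ble_refl.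
  have := fZ_le a^-1 (a *: x); rewrite invr_ge0 scalerK// => h.
  rewrite -[f (a *: x)](scalerKV an0); apply: bleZ => //; apply: h => //.
  exact: bleZ_ge0.
- exact: f0.
exists P; split=> //.
  by apply: op_le_intro P0.1 _ => // x x0; rewrite Pf// ub// ble_refl.
move=> V V0 TV; apply: (op_le_intro P0.1 V0.1) => x x0.
rewrite Pf//; apply/lub => // y y0 yx.
exact: bleT (op_leP TV y0) (positive_homo V0 yx).
Qed.

Lemma regular_positive_part T : dedekind_complete E -> regular E T ->
  exists P, is_positive_part T P.
Proof.
move=> dcE [T1 [T2 [T10 T20 ->]]].
apply: (@positive_part_exists _ T1) => //; last exact: op_le_subl.
exact: lin_sub T10.1 T20.1.
Qed.

(** In any ordered group positive parts give all lattice operations: the join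
    of [S] and [T] is [T + (S - T)^+] and their meet is [S - (S - T)^+]. *)
Lemma sublattice_of_positive_parts (C : set (E -> E)) :
  op_subspace C -> C `<=` regular E ->
  (forall T, C T -> exists2 P, C P & is_positive_part T P) ->
  sublattice_of (regular E) C.
Proof.
move=> [C0 CD] CR Cpos; split=> // S T CS CT.
have CB U V : C U -> C V -> C (U - V).
  by move=> CU CV; rewrite addrC -scaleN1r; exact: CD.
have CA U V : C U -> C V -> C (U + V).
  by move=> CU CV; rewrite -[U]scale1r; exact: CD.
have [P CP [P0 STP Pmin]] := Cpos _ (CB _ _ CS CT); split.
  exists (T + P); [exact: CA|split].
  - exact/CR/CA.
  - by move: STP; rewrite /op_le opprB [T + P]addrC addrA.
  - exact: op_le_addl.
  - move=> V _ SV TV; rewrite /op_le opprD addrA; apply: Pmin => //.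
    by rewrite /op_le opprB addrA subrK.
exists (S - P); [exact: CB|split].
- exact/CR/CB.
- exact: op_le_subl.
- by move: STP; rewrite /op_le !opprB addrCA.
- move=> V _ VS VT; rewrite /op_le addrAC; apply: Pmin => //.
  by rewrite /op_le opprB addrCA [_ - S]addrAC subrr add0r.
Qed.

Lemma regular_sublattice :
  dedekind_complete E -> sublattice_of (regular E) (regular E).
Proof.
move=> dcE; apply: sublattice_of_positive_parts => //.
  exact: regular_subspace.
move=> T /(regular_positive_part dcE)[P PP]; exists P => //.
by apply: positive_regular; have [] := PP.
Qed.

Lemma r_oLW_sublattice :
  dedekind_complete E -> sublattice_of (regular E) (r_oLW E).
Proof.
move=> dcE; apply: sublattice_of_positive_parts.
- exact: r_oLW_subspace.
- exact: r_oLW_regular.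
move=> T rT; have [P PP] := regular_positive_part dcE (r_oLW_regular rT).
exists P => //; have [P0 _ Pmin] := PP.
have [A [oA TA _]] := r_oLW_majorant rT.
apply: positive_oLW_r_oLW; apply: positive_oLW_le P0 _ (oA).
exact: Pmin _ oA.1 TA.
Qed.

End PositivePart.

(** * The operator algebra *)

Section Main.
Context {R : realType} {E : banachLatticeType R}.
Implicit Types (S T U V A B P : E -> E) (x : E).

Lemma r_oLW_subalgebra : subalgebra_of (regular E) (r_oLW E).
Proof.
split; [exact: r_oLW_regular|exact: r_oLW_subspace|exact: r_oLW_comp].
Qed.

Lemma positive_idfun : positive_operator (@idfun E).
Proof. by split. Qed.

(** A difference of positive o-LW operators lies below a positive o-LW operator,
    and if [idfun] does, it is itself o-LW.  Conversely, if all positive elements are disjointly null, then so are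
    the values of any positive operator. *)
Lemma r_oLW_eq_regular : r_oLW E = regular E <-> oLW E E (@idfun E).
Proof.
split=> [e|I_oLW].
  have : r_oLW E (@idfun E).
    by rewrite e; exact: positive_regular positive_idfun.
  move=> /r_oLW_majorant[A [oA IA _]].
  by have [] := positive_oLW_le positive_idfun IA oA.
have oI : positive_oLW (@idfun E) by split; [exact: positive_idfun|].
apply/seteqP; split=> [T|T [T1 [T2 [T10 T20 ->]]]]; first exact: r_oLW_regular.
have oLW_of V : positive_operator V -> positive_oLW V.
  move=> V0; apply: positive_oLW_intro => // x x0.
  exact: (positive_oLW_null oI (V0.2 x x0)).
by exists T1, T2; split=> //; exact: oLW_of.
Qed.

Lemma majorant_positive T U :
  linear T -> op_le T U -> op_le (- T) U -> positive_operator U.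
Proof.
move=> linT TU NTU; split=> [|x x0].
  by rewrite -(subrK T U); apply: lin_add => //; exact: TU.1.
apply: bge0_double; rewrite -(subrr (T x)).
exact: bleD (op_leP TU x0) (op_leP NTU x0).
Qed.

Lemma inf_least (X : set R) m : X m -> lbound X m -> inf X = m.
Proof.
move=> Xm mX; apply/eqP; rewrite eq_le; apply/andP; split.
  by apply: ge_inf => //; exists m.
by apply: lb_le_inf => //; exists m.
Qed.

(** In the Dedekind complete case the modulus of [T] is again o-LW, and it is
    the least element of both sets of majorants that define the norms. *)
Lemma r_oLW_normE T : dedekind_complete E -> r_oLW E T ->
  r_oLW_norm T = regular_norm T.
Proof.
move=> dcE rT; have linT := regular_linear (r_oLW_regular rT).
have rNT : r_oLW E (- T).
  rewrite -scaleN1r -[_ *: _]addr0.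
  exact: r_oLW_subspace.2 _ _ _ rT r_oLW_subspace.1.
have [_ /(_ _ _ rT rNT)[[U _ [_ TU NTU Umin]] _]] := r_oLW_sublattice dcE.
have U0 := majorant_positive linT TU NTU.
have oU : positive_oLW U.
  have [A [oA TA NTA]] := r_oLW_majorant rT.
  apply: positive_oLW_le U0 _ (oA).
  exact: Umin _ (positive_regular oA.1) TA NTA.
have least S : op_le T S -> op_le (- T) S -> op_norm U <= op_norm S.
  move=> TS NTS; apply: op_norm_homo => //; apply: Umin => //.
  exact/positive_regular/(majorant_positive linT).
rewrite /r_oLW_norm /regular_norm !(@inf_least _ (op_norm U))//.
- by exists U => //; split=> //; exact: positive_regular.
- by move=> _ [S [_ TS NTS] <-]; exact: least.
- by exists U => //; split=> //; exact: oU.2.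
- by move=> _ [S [_ TS NTS] <-]; exact: least.
Qed.

(** By minimality [P <= A + U], so [P x <= A x + U x], where [A x] is disjointly
    null and [U x] is small in norm. *)
Lemma approx_positive_part T P : is_positive_part T P ->
  (forall e : R, 0 < e -> exists A U, [/\ positive_oLW A, positive_operator U,
     op_norm U < e & op_le T (A + U)]) ->
  positive_oLW P.
Proof.
move=> [P0 TP Pmin] happ; apply: positive_oLW_intro => // x x0.
apply: disjointly_null_approx => e e0.
have x1 : 0 < `|x| + 1 by rewrite ltr_wpDl.
(* The [+ 1] covers [x = 0]. *)
have [A [U [oA U0 Ue TAU]]] := happ (e / (`|x| + 1)) (divr_gt0 e0 x1).
exists (A x), (U x); split.
- exact: (oA.1.2 x x0).
- exact: (U0.2 x x0).
- exact: (positive_oLW_null oA x0).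
- apply: le_lt_trans (ler_op_norm _ (positive_bounded U0)) _.
  move: Ue; rewrite ltr_pdivlMr//; apply: le_lt_trans.
  by rewrite mulrDr mulr1 lerDl op_norm_ge0//; exact: positive_bounded.
- exact: (op_leP (Pmin _ (positiveD oA.1 U0) TAU) x0).
Qed.

Lemma regular_norm_lt T e : regular E T -> regular_norm T < e ->
  exists U, [/\ positive_operator U, op_norm U < e, op_le T U & op_le (- T) U].
Proof.
move=> rT /inf_lt[|_ [U [_ TU NTU] <-] Ue].
  have [T1 [T2 [T10 T20 ->]]] := rT.
  exists (op_norm (T1 + T2)), (T1 + T2) => //.
  split; first exact/positive_regular/positiveD.
    exact: op_le_sub_add.
  by rewrite opprB [T1 + T2]addrC; exact: op_le_sub_add.
by exists U; split=> //; exact: majorant_positive (regular_linear rT) TU NTU.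
Qed.

(** If [S] is r-o-LW and [U] majorizes [T - S] and [S - T], then [T] and [- T]
    lie below [A + U] for any o-LW majorant [A] of [S] and [- S]. Hence the
    positive parts of [T] and of [- T] are o-LW, and they majorize [T] and
    [- T]. *)
Lemma r_oLW_closed : dedekind_complete E ->
  closed_in_norm (regular E) regular_norm (r_oLW E).
Proof.
move=> dcE T rT happ.
have rNT : regular E (- T).
  rewrite -scaleN1r -[_ *: _]addr0.
  exact: regular_subspace.2 _ _ _ rT regular_subspace.1.
have happ2 (e : R) : 0 < e -> exists A U, [/\ positive_oLW A,
    positive_operator U, op_norm U < e &
    op_le T (A + U) /\ op_le (- T) (A + U)].
  move=> /happ[S rS TSe].
  have rTS : regular E (T - S).
    rewrite addrC -scaleN1r.
    exact: regular_subspace.2 _ _ _ (r_oLW_regular rS) rT.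
  have [U [U0 Ue TSU STU]] := regular_norm_lt rTS TSe.
  have [A [oA SA NSA]] := r_oLW_majorant rS.
  exists A, U; split=> //; split.
    by rewrite -(subrK S T) addrC; exact: op_leD.
  by rewrite -(subrK S T) opprD addrC; exact: op_leD.
have [P PP] := regular_positive_part dcE rT.
have [Q QQ] := regular_positive_part dcE rNT.
apply: (@majorant_r_oLW _ _ T P Q).
- apply: approx_positive_part PP _ => e /happ2[A [U [? ? ? []]]].
  by exists A, U.
- apply: approx_positive_part QQ _ => e /happ2[A [U [? ? ? []]]].
  by exists A, U.
- by have [] := PP.
- by have [] := QQ.
Qed.

Lemma r_oLW_order_ideal : dedekind_complete E ->
  order_ideal_of (regular E) (r_oLW E).
Proof.
move=> dcE; split.
- by split; [exact: regular_subspace|exact: regular_sublattice].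
- exact: r_oLW_regular.
- exact: r_oLW_subspace.
move=> S T absS absT rS rT [_ Sabs NSabs _] [_ _ _ Tmin] absST.
have [A [oA TA NTA]] := r_oLW_majorant rT.
have absT_le : op_le absT A by apply: Tmin => //; exact: positive_regular oA.1.
have absS_le := op_le_trans absST absT_le.
by apply: (majorant_r_oLW oA oA); exact: op_le_trans absS_le.
Qed.

End Main.

Theorem theorem3p4p3 (R : realType) (E : banachLatticeType R) :
  (* (i) *)
  (subalgebra_of (regular E) (r_oLW E) /\
   (r_oLW E = regular E <-> oLW E E (@idfun E))) /\
  (* (ii) *)
  (dedekind_complete E ->
     [/\ riesz_subalgebra_of (regular E) (r_oLW E),
         (forall T : E -> E, r_oLW E T -> r_oLW_norm T = regular_norm T),
         closed_in_norm (regular E) regular_norm (r_oLW E)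
       & order_ideal_of (regular E) (r_oLW E)]).
Proof.
split=> [|dcE].
  by split; [exact: r_oLW_subalgebra|exact: r_oLW_eq_regular].
split.
- by split; [exact: r_oLW_subalgebra|exact: r_oLW_sublattice].
- by move=> T; exact: r_oLW_normE.
- exact: r_oLW_closed.
- exact: r_oLW_order_ideal.
Qed.
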